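(* Let $A \in \mathbb{R}^{m\times n}$ with $m\ge n$ have full column rank and singular values $0<\sigma_1<\sigma_2\le\dots\le\sigma_n$, with $\sigma_2<\sigma_n$. Let $C=A^TA$ and $B = \begin{pmatrix} 0 & A^T \\ A & 0\end{pmatrix}$. Let $$\gamma = \frac{\sigma_2^2-\sigma_1^2}{\sigma_n^2-\sigma_2^2}$$ be the gap ratio of $\sigma_1^2$ in $C$, assumed small, so that in particular $2\sqrt{\gamma}<1$. Then a Krylov method on $C$ that computes $\sigma_1^2$ always has a faster asymptotic convergence rate than a Krylov method on $B$ that finds $\sigma_1$, by a factor of $$\tau = \frac{1-\sqrt{\gamma}\,\sqrt{\dfrac{2\sigma_1}{\sigma_2+\sigma_1}\;\dfrac{\sigma_n^2-\sigma_2^2}{\sigma_n^2-\sigma_1^2}}}{1-2\sqrt{\gamma}};$$ that is, $\tau = \rho/q$ where $\rho$ and $q$ are the asymptotic convergence rates on $B$ and on $C$ respectively (defined in the context), and $\tau>1$.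
   Context: The eigenvalues of $C$ are $\sigma_i^2$; the eigenvalues of $B$ are $\pm\sigma_i$ together with $m-n$ zeros. Asymptotic convergence rates here are measured by the following (first-order) bounds on the asymptotic error reduction factor per iteration, where a smaller value means faster convergence: - For a Krylov method on $B$ that finds $\sigma_1$, the rate is $$\rho = 1-\sqrt{\gamma\;\frac{2\sigma_1}{\sigma_2+\sigma_1}\;\frac{\sigma_n^2-\sigma_2^2}{\sigma_n^2-\sigma_1^2}}.$$ This is $1-\sqrt{bc/(ad)}$ for the two intervals $[-a,-b]\cup[c,d] = [-\sigma_n-\sigma_1,-2\sigma_1]\cup[\sigma_2-\sigma_1,\sigma_n-\sigma_1]$ taken to contain the spectrum of $B-\sigma_1 I$ apart from its zero eigenvalue. - For a Krylov (Lanczos) method on $C$ that computes $\sigma_1^2$, the rate is $q = 1-2\sqrt{\gamma}$ (the first-order approximation of $e^{-2\sqrt{\gamma}}$). The method on $C$ being faster by a factor $\tau$ means $\tau=\rho/q>1$. *)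

(* Defs.v *)
From mathcomp Require Import all_boot all_order all_algebra.
From mathcomp Require Import reals.
From mathcomp Require Import polyrcf.

Set Implicit Arguments.
Unset Strict Implicit.
Unset Printing Implicit Defensive.

Import Order.TTheory GRing.Theory Num.Theory.
Local Open Scope ring_scope.

(* The real eigenvalues of M in nondecreasing order, each repeated according to
   its algebraic multiplicity. For a symmetric M these are all its eigenvalues,
   and the algebraic and geometric multiplicities agree. *)
Definition spectrum (R : realType) (k : nat) (M : 'M[R]_k) : seq R :=
  flatten [seq nseq (mup x (char_poly M)) x | x <- rootsR (char_poly M)].

Definition gram (R : realType) (m n : nat) (A : 'M[R]_(m, n)) : 'M[R]_n :=
  A^T *m A.

Definition augmented (R : realType) (m n : nat) (A : 'M[R]_(m, n)) :
    'M[R]_(n + m) :=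
  block_mx 0 A^T A 0.

(* The i-th smallest singular value of A. The index i starts at 1; the value
   is 0 when i exceeds the number n of columns. *)
Definition sigma (R : realType) (m n : nat) (A : 'M[R]_(m, n)) (i : nat) : R :=
  [seq Num.sqrt x | x <- spectrum (gram A)]`_i.-1.

(* Gap ratio of the smallest eigenvalue l1 of a symmetric matrix with second
   smallest eigenvalue l2 and largest eigenvalue ln. *)
Definition gap_ratio (R : realType) (l1 l2 ln : R) : R := (l2 - l1) / (ln - l2).

(* Convergence rate of a Lanczos method on the symmetric matrix C for its
   smallest eigenvalue, exp (- 2 sqrt gamma) to first order. A rate is an error
   reduction factor per iteration: smaller is faster. *)
Definition lanczos_rate (R : realType) (n : nat) (C : 'M[R]_n) : R :=
  let l := spectrum C in
  1 - 2 * Num.sqrt (gap_ratio l`_0 l`_1 (last 0 l)).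

(* Convergence rate of a Krylov method finding the smallest positive eigenvalue
   s1 of an augmented matrix B, whose positive eigenvalues s1 < s2 <= ... <= sn
   are the nonzero singular values of the off-diagonal block. It is
   1 - sqrt (b c / (a d)) for the intervals [- a, - b] and [c, d] equal to
   [- sn - s1, - 2 s1] and [s2 - s1, sn - s1], which are taken to contain the
   spectrum of B - s1 I apart from 0; the zero eigenvalues that B has when the
   block is not square are disregarded. *)
Definition augmented_rate (R : realType) (k : nat) (B : 'M[R]_k) : R :=
  let s := [seq x <- spectrum B | 0 < x] in
  let s1 := s`_0 in
  let s2 := s`_1 in
  let sn := last 0 s in
  1 - Num.sqrt (gap_ratio (s1 ^+ 2) (s2 ^+ 2) (sn ^+ 2)
                * ((2 * s1) / (s2 + s1))
                * ((sn ^+ 2 - s2 ^+ 2) / (sn ^+ 2 - s1 ^+ 2))).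

(* Main.v *)
Require Import Defs.
From mathcomp Require Import all_boot all_order all_algebra.
From mathcomp Require Import reals.
From mathcomp Require Import polyrcf.
From mathcomp Require Import ring lra.

Import Order.TTheory GRing.Theory Num.Theory.
Local Open Scope ring_scope.

(** The key fact is that the positive eigenvalues of the augmented matrix B of A
    are, with multiplicity, the square roots of the positive eigenvalues of the
    Gram matrix C. For B of size n + m, a block elimination gives
      chi_B * X^n = chi_C(X^2) * X^m,
    so a root x <> 0 of chi_B has the multiplicity of x^2 as a root of chi_C:
    away from 0, the substitution of X^2 for X is unramified
    ([mup_char_poly_augmented]). Since both lists of eigenvalues are sorted,
    equality of multiplicities makes them equal
    ([positive_spectrum_augmented]).

    The rates read off the spectra of B and C are therefore functions of the
    singular values s1 < s2 <= ... <= sn: with gamma the gap ratio,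
      rho = 1 - sqrt gamma * sqrt F,   q = 1 - 2 * sqrt gamma,
      F = 2 s1 / (s2 + s1) * ((sn^2 - s2^2) / (sn^2 - s1^2)).
    Both factors of F lie strictly between 0 and 1 ([interval_factor_lt1]), so
    sqrt F <= 1 < 2 and, as gamma > 0, q < rho; since q > 0, the ratio rho / q
    exceeds 1.

    That all n eigenvalues of C are real and positive is obtained from the
    ordering alone, not from the spectral theorem: sn > 0 is entry n of the
    list of singular values, so the list of real eigenvalues has at least n
    entries, and it has at most n by degree. The first of these is positive
    because s1 is, hence so are all the others. *)

(** * Multiplicities of roots *)

Lemma prod_XsubC_dvdp (F : fieldType) (s : seq F) (p : {poly F}) :
  p != 0 -> (forall x, count_mem x s <= mup x p)%N ->
  \prod_(x <- s) ('X - x%:P) %| p.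
Proof.
elim: s p => [|x s IHs] p p0 le_s; first by rewrite big_nil dvd1p.
have /dvdpP [q Dp] : 'X - x%:P %| p.
  by rewrite XsubC_dvd // (leq_trans _ (le_s x)) //= eqxx.
have q0 : q != 0 by apply: contra_neq p0 => q0; rewrite Dp q0 mul0r.
rewrite big_cons Dp mulrC dvdp_mul2r ?polyXsubC_eq0 //; apply: IHs => // y.
have:= le_s y; rewrite /= Dp mupM ?polyXsubC_eq0 //.
by rewrite (@mup_XsubCX _ 1) addnC; case: (x == y); rewrite leq_add2r.
Qed.

(** The preimages x and - x of x^2 under squaring are distinct, so
    X^2 - x^2 = (X - x) (X + x) contributes one factor X - x for each factor
    of p that vanishes at x^2. *)
Lemma mup_comp_sqr (F : fieldType) (p : {poly F}) (x : F) :
  p != 0 -> x != - x -> mup x (p \Po 'X^2) = mup (x ^+ 2) p.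
Proof.
move=> p0 xNx.
have [k [q]] := multiplicity_XsubC p (x ^+ 2); rewrite p0 /= => qx ->.
rewrite mupMr // mup_XsubCX eqxx comp_polyM mupMr; last first.
  by rewrite root_comp hornerXn.
have -> : ('X - (x ^+ 2)%:P) ^+ k \Po 'X^2
          = ('X - x%:P) ^+ k * ('X - (- x)%:P) ^+ k.
  rewrite rmorphXn /= comp_polyB comp_polyX comp_polyC -exprMn; congr (_ ^+ _).
  by rewrite polyCN polyC_exp; ring.
rewrite mupMl ?mup_XsubCX ?eqxx //.
rewrite rootE horner_exp !hornerE expf_neq0 //.
by rewrite opprK -[x in _ + x]opprK subr_eq0.
Qed.

(** * Sorted lists of real eigenvalues *)

Section Spectrum.
Variables (R : realType) (k : nat) (M : 'M[R]_k).

Lemma count_spectrum (x : R) : count_mem x (spectrum M) = mup x (char_poly M).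
Proof.
have p0 : char_poly M != 0 := monic_neq0 (char_poly_monic M).
rewrite /spectrum count_flatten -map_comp sumnE big_map.
under eq_bigr => y _ do rewrite /= count_nseq /=.
have := roots_on_rootsR p0 x; rewrite in_itv /= => root_x.
have := uniq_roots (- cauchy_bound (char_poly M)) (cauchy_bound (char_poly M))
  (char_poly M); rewrite -/(rootsR _) => rootsU.
case: (boolP (root (char_poly M) x)) => [rx | nrx].
  rewrite (bigD1_seq x) -?root_x //= eqxx mul1n big1 ?addn0 // => y /negPf.
  by move=> ->.
rewrite (mupNroot nrx) big_seq big1 // => y y_in.
case: eqP => // Dy; move: nrx; rewrite root_x.
by rewrite -Dy y_in.
Qed.

(** The roots are listed in strictly increasing order, and repeating each of
    them in place keeps the order weakly increasing. *)
Lemma sorted_spectrum : sorted <=%R (spectrum M).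
Proof.
rewrite /spectrum; have := sorted_roots (- cauchy_bound (char_poly M))
  (cauchy_bound (char_poly M)) (char_poly M); rewrite -/(rootsR _).
rewrite (sorted_pairwise lt_trans) (sorted_pairwise le_trans).
elim: (rootsR _) => //= x s IHs /andP [lt_xs /IHs les].
rewrite pairwise_cat les andbT; apply/andP; split.
  apply/allrelP => y z /nseqP [-> _] /flattenP [_ /mapP [t ts ->]] /nseqP [-> _].
  exact/ltW/(allP lt_xs).
by elim: (mup _ _) => //= j ->; rewrite andbT; apply/allP => y /nseqP [->].
Qed.

(** The product of X - x over the list divides the characteristic polynomial,
    whose degree is k. *)
Lemma size_spectrum : (size (spectrum M) <= k)%N.
Proof.
have p0 : char_poly M != 0 := monic_neq0 (char_poly_monic M).
rewrite -ltnS -(size_char_poly M) -(size_prod_XsubC _ id) dvdp_leq //.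
by apply: prod_XsubC_dvdp => // x; rewrite count_spectrum.
Qed.

End Spectrum.

(** * The spectrum of the augmented matrix *)

(** The block column operation by [X, 0; A, 1], of determinant X^n, clears the
    lower left block of X - B and turns the upper left one into X^2 - A^T A.
    Multiplying by powers of X rather than dividing by them keeps the identity
    among polynomials, whichever of m and n is larger. *)
Lemma char_poly_augmented (R : realType) (m n : nat) (A : 'M[R]_(m, n)) :
  char_poly (augmented A) * 'X^n = (char_poly (gram A) \Po 'X^2) * 'X^m.
Proof.
have -> : char_poly (gram A) \Po 'X^2
          = \det ('X^2%:M - map_mx polyC (A^T *m A)).
  rewrite /char_poly -[LHS](det_map_mx (comp_poly 'X^2)); congr (\det _).
  rewrite /char_poly_mx map_mxB map_scalar_mx /= comp_polyX.
  by congr (_ - _); apply/matrixP => i j; rewrite !mxE comp_polyC.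
have -> : char_poly (augmented A)
          = \det (block_mx ('X%:M : 'M_n) (- map_mx polyC A^T)
                           (- map_mx polyC A) ('X%:M : 'M_m)).
  rewrite /char_poly /char_poly_mx scalar_mx_block map_block_mx !map_mx0.
  by rewrite opp_block_mx add_block_mx !oppr0 !addr0 !add0r.
transitivity (\det (block_mx ('X%:M : 'M_n) (- map_mx polyC A^T)
                             (- map_mx polyC A) ('X%:M : 'M_m)
                    *m block_mx 'X%:M 0 (map_mx polyC A) 1%:M)).
  by rewrite det_mulmx det_lblock det1 mulr1 det_scalar.
rewrite mulmx_block !mulNmx !mulmx1 !mulmx0 add0r.
rewrite !(mul_scalar_mx, mul_mx_scalar) addNr oppr0 add0r.
rewrite det_ublock det_scalar; congr (\det _ * _).
by rewrite map_mxM /= scale_scalar_mx -expr2.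
Qed.

Lemma mup_char_poly_augmented (R : realType) (m n : nat) (A : 'M[R]_(m, n))
    (x : R) :
  x != 0 ->
  mup x (char_poly (augmented A)) = mup (x ^+ 2) (char_poly (gram A)).
Proof.
move=> x0; have nX j : ~~ root ('X^j : {poly R}) x.
  by rewrite rootE hornerXn expf_neq0.
rewrite -(mupMl _ (nX n)) char_poly_augmented mupMl // mup_comp_sqr //.
  exact: monic_neq0 (char_poly_monic _).
by rewrite -subr_eq0 opprK -mulr2n mulrn_eq0.
Qed.

(** A sorted list is determined by its multiplicities, so it suffices to count
    each x: both counts vanish for x <= 0, and for x > 0 they are the
    multiplicities of x in B and of x^2 in the Gram matrix. *)
Lemma positive_spectrum_augmented (R : realType) (m n : nat) (A : 'M[R]_(m, n)) :
  [seq x <- spectrum (augmented A) | 0 < x]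
  = [seq Num.sqrt l | l <- spectrum (gram A) & 0 < l].
Proof.
apply: le_sorted_eq.
- exact/(sorted_filter le_trans)/sorted_spectrum.
- apply: (homo_sorted (f := Num.sqrt)); first exact: ler_wsqrtr.
  exact/(sorted_filter le_trans)/sorted_spectrum.
apply/allP => x _; apply/eqP; rewrite /= count_map !count_filter.
have [x_gt0 | x_le0] := ltP 0 x; last first.
  rewrite !(eq_count (a2 := pred0)) ?count_pred0 // => y /=.
  - apply/negP => /andP [/eqP Dx y0]; move: x_le0; rewrite -Dx leNgt.
    by rewrite sqrtr_gt0 y0.
  - by apply/negP => /andP [/eqP -> ]; rewrite ltNge x_le0.
transitivity (count_mem x (spectrum (augmented A))).
  by apply: eq_count => y /=; case: eqP => // ->; rewrite x_gt0.
rewrite count_spectrum mup_char_poly_augmented ?gt_eqF // -count_spectrum.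
apply: eq_count => y /=; apply/eqP/andP => [-> | [/eqP <- y0]].
  by rewrite sqrtr_sqr gtr0_norm // exprn_gt0.
by rewrite sqr_sqrtr // ltW.
Qed.

(** * Comparison of the two rates *)

(** Each of the two factors is positive and below 1: a < b bounds the first,
    and it makes the numerator of the second smaller than its denominator. *)
Lemma interval_factor_lt1 (R : realFieldType) (a b c : R) :
  0 < a -> a < b -> b < c ->
  (2 * a) / (b + a) * ((c ^+ 2 - b ^+ 2) / (c ^+ 2 - a ^+ 2)) < 1.
Proof.
move=> a0 ab bc; have ac := lt_trans ab bc; have b0 := lt_trans a0 ab.
rewrite !expr2 mulr_ilt1 //; first by rewrite divr_ge0; nra.
- by rewrite divr_ge0 // subr_ge0; nra.
- by rewrite ltr_pdivrMr ?mul1r; lra.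
- by rewrite ltr_pdivrMr ?mul1r; nra.
Qed.

Theorem theorem2p5 (R : realType) (m n : nat) (A : 'M[R]_(m, n))
    (le_nm : (n <= m)%N) (rankA : \rank A = n) :
  let s1 := sigma A 1 in
  let s2 := sigma A 2 in
  let sn := sigma A n in
  let gamma := (s2 ^+ 2 - s1 ^+ 2) / (sn ^+ 2 - s2 ^+ 2) in
  let rho := augmented_rate (augmented A) in
  let q := lanczos_rate (gram A) in
  let tau := rho / q in
  0 < s1 -> s1 < s2 -> s2 < sn ->
  2 * Num.sqrt gamma < 1 ->
  tau = (1 - Num.sqrt gamma
             * Num.sqrt ((2 * s1) / (s2 + s1)
                         * ((sn ^+ 2 - s2 ^+ 2) / (sn ^+ 2 - s1 ^+ 2))))
        / (1 - 2 * Num.sqrt gamma)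
  /\ 1 < tau.
Proof.
move=> s1 s2 sn gamma rho q tau s1_gt0 s12 s2n small.
set l := spectrum (gram A).
(* The list defaults to 0 past its end, so sn > 0 bounds its size below. *)
have ltn : (n.-1 < size l)%N.
  rewrite ltnNge; apply/negP => le_ln; move: s2n; rewrite ltNge {1}/sn /sigma.
  rewrite (nth_default _ (_ : size (map _ l) <= _)%N) ?size_map //.
  by rewrite (ltW (lt_trans s1_gt0 s12)).
have n_gt0 : (0 < size l)%N by case: (size l) ltn.
have n_eq : size l = n.
  by apply/eqP; rewrite eqn_leq size_spectrum; case: (n) ltn.
have n_gt1 : (1 < size l)%N.
  rewrite ltnNge; apply/negP => le_l1; move: (lt_trans s1_gt0 s12).
  by rewrite /s2 /sigma nth_default ?ltxx // size_map.
have l1_gt0 : 0 < l`_0.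
  by move: s1_gt0; rewrite /s1 /sigma /= (nth_map 0) // sqrtr_gt0.
have l_gt0 : {in l, forall x, 0 < x}.
  move=> x xl; apply: lt_le_trans l1_gt0 _.
  rewrite -(nth_index 0 xl) (sorted_leq_nth le_trans lexx) ?sorted_spectrum //.
  by rewrite inE index_mem.
have sigma_sq i : (i < size l)%N -> (Num.sqrt l`_i) ^+ 2 = l`_i.
  by move=> lt_i; rewrite sqr_sqrtr // ltW // l_gt0 // mem_nth.
have s1E : s1 = Num.sqrt l`_0 by rewrite /s1 /sigma (nth_map 0).
have s2E : s2 = Num.sqrt l`_1 by rewrite /s2 /sigma (nth_map 0).
have lastE : last 0 l = l`_n.-1 by rewrite -nth_last n_eq.
have snE : sn = Num.sqrt (last 0 l) by rewrite /sn /sigma (nth_map 0) // lastE.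
have qE : q = 1 - 2 * Num.sqrt gamma.
  rewrite /q /lanczos_rate -/l /gap_ratio /gamma s1E s2E snE lastE.
  by rewrite !sigma_sq.
have g_gt0 : 0 < gamma.
  by apply: divr_gt0; rewrite subr_gt0 !expr2; nra.
set F := (2 * s1) / (s2 + s1) * _.
have rhoE : rho = 1 - Num.sqrt gamma * Num.sqrt F.
  rewrite /rho /augmented_rate positive_spectrum_augmented -/l.
  rewrite (all_filterP (_ : all _ l)); last by apply/allP => x /l_gt0.
  rewrite -[last 0 (map _ _)]nth_last size_map n_eq.
  rewrite -/(sigma A 1) -/(sigma A 2) -/(sigma A n).
  by rewrite /gap_ratio -mulrA sqrtrM // ltW.
have F_lt1 : F < 1 := interval_factor_lt1 _ _ _ _ s1_gt0 s12 s2n.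
split; first by rewrite /tau rhoE qE.
rewrite /tau qE ltr_pdivlMr ?subr_gt0 // mul1r rhoE ltrD2l ltrN2.
have sg : 0 < Num.sqrt gamma by rewrite sqrtr_gt0.
rewrite [ltRHS]mulrC ltr_pM2l // (le_lt_trans (_ : _ <= 1)) ?ltr1n //.
by rewrite -[leRHS]sqrtr1 ler_wsqrtr // ltW.
Qed.
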